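(* There exists an absolute constant $C\approx 12.0412$ such that the following holds. Let $(X,\mathcal{H})$ be a Littlestone class with $\operatorname{Ldim}(\mathcal{H})=\ell$ and $\operatorname{VC}(\mathcal{H})=d\geq 1$. If $0<\epsilon<\frac{1}{Cd}$, then $\mathcal{H}_\infty(\epsilon)$ is Littlestone. More precisely, there is a function $B$ of two real variables (independent of $\mathcal{H}$) such that, given $d$, one is free to choose: (1) any constant $\mathbf{C}\ge C$; (2) based on $\mathbf{C}$, any $\epsilon_1\in(0,1/2)$ with $\mathbf{C}d>20\cdot (d/\epsilon_1)\cdot\log_{10}(1/\epsilon_1)$; (3) based on $\epsilon_1$, any $\epsilon_2\in(0,1/2)$ with $\epsilon_1<\epsilon_2$; (4) based on $\epsilon_2$, any $\epsilon_3\in(0,1/2-\epsilon_2)$; and then, for $0<\epsilon<\frac{1}{\mathbf{C}d}$, the Littlestone dimension of $\mathcal{H}_\infty(\epsilon)$ is upper bounded in terms of $d/\epsilon_3^2$ and $\ell$, i.e. $\operatorname{Ldim}(\mathcal{H}_\infty(\epsilon))\le B(d/\epsilon_3^2,\ell)<\infty$.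
   Context: A hypothesis class $(X,\mathcal{H})$ is a set $X$ (finite or infinite) together with a set $\mathcal{H}$ of functions $h:X\to\{0,1\}$. For $0<\epsilon<1/2$, an $\epsilon$-hypothesis of $\mathcal{H}$ is a finite set of pairs $H=\{(h_i,\gamma_i):i<k\}$ with $h_i\in\mathcal{H}$ pairwise distinct, $\gamma_i\in(0,1]$ real, $\sum_i\gamma_i=1$, such that for every $x\in X$ there is a value $\mathbf{t}_H(x)\in\{0,1\}$ with $\sum\{\gamma_i:h_i(x)=1-\mathbf{t}_H(x)\}<\epsilon$. This defines $\mathbf{t}_H:X\to\{0,1\}$. $\epsilon$-saturation: $\mathcal{H}_0(\epsilon)=\mathcal{H}$; $\mathcal{H}_{n+1}(\epsilon)=\mathcal{H}_n(\epsilon)\cup\{\mathbf{t}_H: H\text{ is an }\epsilon\text{-hypothesis of }\mathcal{H}_n(\epsilon)\}$ (as a set of functions on $X$); $\mathcal{H}_\infty(\epsilon)=\bigcup_{n<\omega}\mathcal{H}_n(\epsilon)$. $\operatorname{Ldim}(\mathcal{H})$ is the Littlestone dimension: the greatest $m$ (or $\infty$ if there is no greatest) for which there is a full binary tree of height $m$ with internal nodes labelled by elements of $X$ such that every branch $\langle(x_i,y_i):1\le i\le m\rangle$ ($x_i$ the $i$-th node label, $y_i=1$ for going right and $0$ for left) is realized by some $h\in\mathcal{H}$, i.e. $h(x_i)=y_i$ for all $i$. A class is Littlestone if $\operatorname{Ldim}<\infty$. $\operatorname{VC}(\mathcal{H})$ is the Vapnik–Chervonenkis dimension. *)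

(* Defs.v *)
From HB Require Import structures.
From mathcomp Require Import all_boot all_order all_algebra.
From mathcomp Require Import all_classical all_reals all_analysis.
Set Implicit Arguments.
Unset Strict Implicit.
Unset Printing Implicit Defensive.
Import Order.TTheory GRing.Theory Num.Theory.
Local Open Scope classical_set_scope.
Local Open Scope ring_scope.

Definition log10 (R : realType) (x : R) : R := ln x / ln 10.

(* The values 0 and 1 of a hypothesis are [false] and [true]. *)
Definition hclass (X : Type) := set (X -> bool).

(* [sup_nat R P] is the greatest natural number satisfying [P], or [+oo] if [P]
   is unbounded (see [sup_natP], [sup_natyP]); it is [-oo] when [P] is empty. *)
Definition sup_nat (R : realType) (P : set nat) : \bar R :=
  ereal_sup [set (n%:R : R)%:E | n in P].

Lemma sup_natP (R : realType) (P : set nat) (m : nat) :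
  sup_nat R P = (m%:R : R)%:E <-> P m /\ forall n, P n -> (n <= m)%N.
Proof.
split=> [supE|[Pm mP]].
- have ub n : P n -> (n <= m)%N.
    move=> Pn; rewrite -(ler_nat R) -lee_fin -supE.
    by apply: ereal_sup_ubound; exists n.
  split=> //.
  have /ereal_sup_gt[_ [n Pn <-]] : ((m%:R - 1 : R)%:E < sup_nat R P)%E.
    by rewrite supE lte_fin ltrBlDr ltrDl.
  rewrite lte_fin ltrBlDr natr1 ltr_nat ltnS => lemn.
  by have/eqP -> : m == n by rewrite eqn_leq lemn ub.
- apply/le_anti/andP; split; last by apply: ereal_sup_ubound; exists m.
  by apply: ge_ereal_sup => _ [n Pn <-]; rewrite lee_fin ler_nat mP.
Qed.

Lemma sup_natyP (R : realType) (P : set nat) :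
  sup_nat R P = +oo%E <-> forall m, exists2 n, P n & (m < n)%N.
Proof.
split=> [supE m|Py].
- have /ereal_sup_gt[_ [n Pn <-]] : ((m%:R : R)%:E < sup_nat R P)%E.
    by rewrite supE ltry.
  by rewrite lte_fin ltr_nat => mn; exists n.
- apply/eqP; rewrite -leye_eq leNgt; apply/negP.
  have [n0 Pn0 _] := Py 0%N.
  have : ((n0%:R : R)%:E <= sup_nat R P)%E by apply: ereal_sup_ubound; exists n0.
  case supE: (sup_nat R P) => [r||] //; rewrite lee_fin => n0r _.
  have [n Pn] := Py (Num.bound `|r|); rewrite -(ltr_nat R) => bn.
  have : ((n%:R : R)%:E <= sup_nat R P)%E by apply: ereal_sup_ubound; exists n.
  rewrite supE lee_fin leNgt => /negP; apply.
  apply: lt_trans bn.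
  by apply: le_lt_trans (ler_norm r) (archi_boundP _).
Qed.

(* Binary trees whose internal nodes carry a point of X; the first subtree is
   the left one. *)
Inductive btree (X : Type) : Type :=
| Leaf
| Node of X & btree X & btree X.
Arguments Leaf {X}.

Fixpoint full (X : Type) (m : nat) (t : btree X) : bool :=
  match m, t with
  | 0%N, Leaf => true
  | m'.+1, Node _ l r => full m' l && full m' r
  | _, _ => false
  end.

(* The branch <(x_i, y_i)> of [t] that goes right at level i when y_i = true,
   and left when y_i = false. *)
Fixpoint branch (X : Type) (t : btree X) (y : seq bool) : seq (X * bool) :=
  match t, y with
  | Node x l r, b :: y' => (x, b) :: branch (if b then r else l) y'
  | _, _ => [::]
  end.

Definition realizes (X : Type) (h : X -> bool) (s : seq (X * bool)) : bool :=
  all (fun p => h p.1 == p.2) s.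

Definition tree_shattered (X : Type) (H : hclass X) (m : nat) (t : btree X)
    : Prop :=
  forall y : m.-tuple bool, exists2 h, H h & realizes h (branch t y).

Definition Ldim (R : realType) (X : Type) (H : hclass X) : \bar R :=
  sup_nat R [set m | exists2 t : btree X, full m t & tree_shattered H m t].

Definition littlestone (R : realType) (X : Type) (H : hclass X) : Prop :=
  (Ldim R H < +oo)%E.

Definition VCdim (R : realType) (X : Type) (H : hclass X) : \bar R :=
  sup_nat R [set n | exists2 x : 'I_n -> X, injective x &
    forall y : 'I_n -> bool, exists2 h, H h & forall i, h (x i) = y i].

(* [t] is the function t_H for the weighted family H = {(h_i, g_i) : i < k};
   it is unique when eps < 1/2 (see [is_tH_unique]). *)
Definition is_tH (R : realType) (X : Type) (eps : R) (k : nat)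
    (h : 'I_k -> X -> bool) (g : 'I_k -> R) (t : X -> bool) : Prop :=
  forall x, \sum_(i < k | h i x == ~~ t x) g i < eps.

Definition eps_hypothesis (R : realType) (X : Type) (H : hclass X) (eps : R)
    (k : nat) (h : 'I_k -> X -> bool) (g : 'I_k -> R) : Prop :=
  [/\ forall i, H (h i),
      injective h,
      forall i, 0 < g i <= 1,
      \sum_(i < k) g i = 1
    & forall x, exists b : bool, \sum_(i < k | h i x == ~~ b) g i < eps].

Lemma is_tH_unique (R : realType) (X : Type) (H : hclass X) (eps : R) (k : nat)
    (h : 'I_k -> X -> bool) (g : 'I_k -> R) (t t' : X -> bool) :
  eps < 1 / 2 -> eps_hypothesis H eps h g ->
  is_tH eps h g t -> is_tH eps h g t' -> t = t'.
Proof.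
move=> eps2 [_ _ _ g1 _] tP t'P; apply/funext => x; apply/eqP/negPn/negP => tt'.
suff : (1 : R) < 1 by rewrite ltxx.
rewrite -{1}g1 (bigID (fun i => h i x == ~~ t x)) /=.
have -> : \sum_(i < k | h i x != ~~ t x) g i = \sum_(i < k | h i x == ~~ t' x) g i.
  by apply: eq_bigl => i; move: tt'; case: (h i x) (t x) (t' x) => [] [] [].
apply: lt_trans (ltrD (tP x) (t'P x)) _.
by rewrite [ltRHS](splitr 1) ltrD.
Qed.

Fixpoint saturation_step (R : realType) (X : Type) (H : hclass X) (eps : R)
    (n : nat) : hclass X :=
  if n is n'.+1 then
    saturation_step H eps n' `|`
    [set t | exists k (h : 'I_k -> X -> bool) (g : 'I_k -> R),
       eps_hypothesis (saturation_step H eps n') eps h g /\ is_tH eps h g t]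
  else H.

Definition saturation (R : realType) (X : Type) (H : hclass X) (eps : R)
    : hclass X :=
  \bigcup_n saturation_step H eps n.

(* Main.v *)
Require Import Defs.
From HB Require Import structures.
From mathcomp Require Import all_boot all_order all_algebra.
From mathcomp Require Import all_classical all_reals all_analysis.
From mathcomp Require Import lra ring zify.
Set Implicit Arguments.
Unset Strict Implicit.
Unset Printing Implicit Defensive.
Import Order.TTheory GRing.Theory Num.Theory.
Local Open Scope classical_set_scope.
Local Open Scope ring_scope.

(** The theorem holds with C = 12.0412 because only C >= 12 matters, and the
    bound on the Littlestone dimension of the saturation can be taken linear in
    that of the class.

    Let f belong to the saturation.  If N * eps < 1, then f agrees with some h
    in H on any N given points: the hypotheses voting against f at one of the N
    points have total weight below N * eps < 1, so some voter agrees with f at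
    all of them, and one recurses on the level of this voter
    ([saturation_agrees]).  When eps < 1 / (C * d), this applies to N = 12 * d.

    Agreement on 12 * d points is enough to learn f weakly: on any finite
    sequence of points, f is followed by some h in H up to a proportion of
    errors below 3/7 ([weak_learner]).  This is an epsilon-net theorem whose
    net has size linear in d because the error only has to be a constant below
    1/2.  It is proved by double sampling ([double_sampling]), and the number
    of patterns on the double sample is bounded by the Sauer-Shelah lemma
    ([card_patterns]).

    Hence if the saturation shatters a full tree of height m, then on each of
    its 2 ^ m branches some h in H makes at most 3m/7 errors.  But for a class
    of Littlestone dimension ell, a random branch is followed with that
    precision with a probability which decreases exponentially in m, up to a
    factor exponential in ell.  The quantitative form of this claim
    ([weight_tree]) is the analogue for trees of the Sauer-Shelah lemma, in
    which a hypothesis making k errors on a branch is counted with weight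
    beta ^ k.  So m is at most linear in ell ([height_le]). *)

(** * Agreement of the saturation with the class on few points *)

Definition agrees_on (X : Type) (N : nat) (H : hclass X) (f : X -> bool) :=
  forall q : 'I_N -> X, exists2 h, H h & forall j, h (q j) = f (q j).

(** Union bound over the N points, by induction on the saturation level. *)
Lemma saturation_agrees (R : realType) (X : Type) (H : hclass X) (eps : R)
    (N : nat) (f : X -> bool) :
  N%:R * eps < 1 -> saturation H eps f -> agrees_on N H f.
Proof.
move=> Neps [n _]; elim: n f => [|n IHn] f /=; first by move=> Hf q; exists f.
case=> [|[k [h [g [[Hh _ g01 g1 _] tH]]]] q]; first exact: IHn.
suff [i hiq] : exists i, forall j, h i (q j) = f (q j).
  by have [h' Hh' h'q] := IHn _ (Hh i) q; exists h' => // j; rewrite h'q.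
apply/not_existsP => bad.
have g_ge0 i : 0 <= g i by have /andP[/ltW] := g01 i.
suff : 1 <= N%:R * eps by rewrite leNgt Neps.
have -> : N%:R * eps = \sum_(j < N) eps by rewrite sumr_const card_ord mulr_natl.
(* Each voter disagrees with f somewhere, so it is counted for some j. *)
apply: (@le_trans _ _ (\sum_(j < N) \sum_(i < k | h i (q j) == ~~ f (q j)) g i)).
  rewrite -g1 (exchange_big_dep predT) //=; apply: ler_sum => i _.
  have /existsNP[j /eqP hj] := bad i.
  rewrite (bigD1 j) /=; last by move: hj; case: (h i _) (f _) => [] [].
  by rewrite lerDl sumr_ge0.
by apply: ler_sum => j _; apply/ltW/tH.
Qed.

(** * Sums over boolean vectors *)

Lemma big_tuple_cons (A : Type) (idx : A) (op : Monoid.com_law idx) (n : nat)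
    (F : n.+1.-tuple bool -> A) :
  \big[op/idx]_y F y = op (\big[op/idx]_(y : n.-tuple bool) F [tuple of false :: y])
                          (\big[op/idx]_(y : n.-tuple bool) F [tuple of true :: y]).
Proof.
rewrite (reindex (fun p : bool * n.-tuple bool => [tuple of p.1 :: p.2])) /=.
  rewrite -(pair_big predT predT (fun b (y : n.-tuple bool) => F [tuple of b :: y])) /=.
  by rewrite big_bool Monoid.mulmC.
exists (fun y => (thead y, [tuple of behead y])) => [[b y] _|y _].
  by rewrite theadE; congr pair; apply: val_inj.
by rewrite -tuple_eta.
Qed.

Lemma card_tuple_cons (n : nat) (P : {set n.+1.-tuple bool}) :
  #|P| = (#|[set y : n.-tuple bool | [tuple of false :: y] \in P]%SET| +
          #|[set y : n.-tuple bool | [tuple of true :: y] \in P]%SET|)%N.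
Proof.
rewrite -!sum1_card [LHS]big_mkcond big_tuple_cons -!big_mkcond /=.
by congr addn; apply: eq_bigl => y; rewrite inE.
Qed.

(** * The number of patterns of a class of bounded VC dimension *)

Definition patterns (T : eqType) (A : hclass T) (s : seq T) :
    {set (size s).-tuple bool} :=
  [set v : (size s).-tuple bool | `[< exists2 h, A h & map h s = v >]]%SET.

Definition seq_shattered (T : eqType) (A : hclass T) (u : seq T) : Prop :=
  forall v : seq bool, size v = size u -> exists2 h, A h & map h u = v.

Definition no_shattered_seq (T : eqType) (A : hclass T) (s : seq T) (k : nat) :=
  forall u, subseq u s -> size u = k -> ~ seq_shattered A u.

(** The functions whose restriction to [s] extends in both ways at [x] within
    [A]; this is the class of patterns that are counted twice when [x] is added
    to [s]. *)
Definition free_at (T : eqType) (A : hclass T) (x : T) (s : seq T) : hclass T :=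
  [set h : T -> bool | forall b, exists2 h', A h' & h' x = b /\ map h' s = map h s].

Lemma patterns_cons (T : eqType) (A : hclass T) (x : T) (s : seq T) :
  #|patterns A (x :: s)| = (#|patterns A s| + #|patterns (free_at A x s) s|)%N.
Proof.
rewrite card_tuple_cons -cardsUI; congr addn; apply: eq_card => v.
- rewrite !inE -asbool_or; apply/asboolP/asboolP.
    by case=> -[h Ah [_ hv]]; exists h.
  case=> h Ah hv; case hx: (h x); [right|left]; exists h => //=; by rewrite hx hv.
- rewrite !inE -asbool_and; apply/asboolP/asboolP.
    case=> -[h Ah [hx hv]] [h' Ah' [h'x h'v]]; exists h => // -[].
      by exists h'; rewrite // h'x h'v hv.
    by exists h.
  case=> h hA hv.
  by split; [have [h' Ah' [h'x h's]] := hA false|have [h' Ah' [h'x h's]] := hA true];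
    exists h' => //=; rewrite h'x h's hv.
Qed.

Lemma no_shattered_seq0 (T : eqType) (A : hclass T) (s : seq T) :
  no_shattered_seq A s 0 -> #|patterns A s| = 0%N.
Proof.
move=> nA; apply: eq_card0 => v; rewrite inE; apply/asboolP => -[h Ah _].
case: (nA [::]) => //; first exact: sub0seq.
by case=> // _; exists h.
Qed.

(** Sauer-Shelah lemma.  The recursion of [patterns_cons] is that of the sum of
    the binomial coefficients 'C(n, i) for i <= d, since a sequence shattered by
    the class [free_at A x s] can be extended by [x] to a sequence shattered by
    [A].  The exponential bound satisfies the same recursion and spares any
    estimate of binomial coefficients. *)
Lemma card_patterns (R : realFieldType) (T : eqType) (A : hclass T) (s : seq T)
    (d : nat) (K : R) :
  1 <= K -> no_shattered_seq A s d.+1 ->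
  (#|patterns A s|%:R : R) <= K ^+ d * (1 + K^-1) ^+ size s.
Proof.
move=> K1; have K0 : 0 < K by apply: lt_le_trans K1.
have K10 : 0 <= 1 + K^-1 by rewrite addr_ge0 // invr_ge0 ltW.
elim: s A d => [|x s IHs] A d nA.
  rewrite /= expr0 mulr1; apply: (@le_trans _ _ 1); last exact: exprn_ege1.
  by rewrite (ler_nat R _ 1) (leq_trans (max_card _)) // card_tuple.
rewrite patterns_cons; set A' := free_at A x s; rewrite natrD.
have nAs : no_shattered_seq A s d.+1.
  by move=> u us; apply: nA; apply: subseq_trans us (subseq_cons _ _).
have nA' : no_shattered_seq A' s d.
  move=> u us ud shat; case: (nA (x :: u)) => /=; [by rewrite eqxx|by rewrite ud|].
  move=> [//|b v] [] /shat[h A'h hv]; have [h' Ah' [h'x h's]] := A'h b.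
  exists h' => //=; rewrite h'x -hv; congr cons.
  by have [m _ ->] := subseqP us; rewrite !map_mask h's.
have := IHs _ _ nAs; rewrite /= [_ ^+ (size s).+1]exprS.
case: d nA' {nA nAs} => [/no_shattered_seq0 -> |d /IHs].
  rewrite !expr0 !mul1r addr0 => /le_trans; apply.
  by rewrite ler_peMl ?exprn_ge0 // lerDl invr_ge0 ltW.
move=> h1 h2; apply: le_trans (lerD h2 h1) _.
rewrite exprS; set a := _ ^+ d; set b := _ ^+ size s.
by rewrite le_eqVlt; apply/orP; left; apply/eqP; field; rewrite gt_eqF.
Qed.

Lemma card_ffun_patterns (I : finType) (A : hclass I) :
  (#|[set P : {ffun I -> bool} | `[< A P >]]%SET| <= #|patterns A (enum I)|)%N.
Proof.
pose f (P : {ffun I -> bool}) := map_tuple P (in_tuple (enum I)).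
have f_inj : injective f.
  move=> P Q /(congr1 val) /= /eq_in_map PQ; apply/ffunP => i.
  by apply: PQ; rewrite mem_enum.
rewrite -(card_imset _ f_inj); apply/subset_leq_card/fintype.subsetP => v /imsetP[P].
by rewrite inE => /asboolP AP ->; rewrite inE; apply/asboolP; exists P.
Qed.

(** * Double sampling *)

(** [G] is a class of error patterns, each of density at least [e], and [B]
    bounds the number of its patterns on 2N points.  If every sample of N points
    is missed by a member of [G], then (1 + e) ^ N <= B.

    Draw a sample and a ghost sample of N points each, let [g s] be a member of
    [G] missing the sample [s], and consider the mean of 2 ^ k, where k is the
    number of points of the ghost sample hit by [g s].  As [g s] is heavy, this
    mean is at least (1 + e) ^ N.  On the other hand it does not change when the
    two samples are swapped at random coordinates.  For a fixed pattern P on the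
    two samples, the mean over the swaps of 2 ^ k, restricted to the swaps for
    which P misses the sample, is a product over the coordinates of factors at
    most 1: a coordinate hit exactly once by P has weight 2 with probability
    1/2, which is why the base 2 is chosen.  Summing over the patterns gives the
    upper bound B. *)
Lemma double_sampling (R : realFieldType) (T : finType) (G : hclass T) (N : nat)
    (e B : R) :
  (0 < #|T|)%N -> 0 <= e ->
  (forall g, G g -> e * #|T|%:R <= \sum_x (g x)%:R) ->
  agrees_on N G (fun=> false) ->
  (forall q : 'I_N * bool -> T,
     #|[set P : {ffun 'I_N * bool -> bool} |
          `[< exists2 g, G g & P =1 g \o q >]]%SET|%:R <= B) ->
  (1 + e) ^+ N <= B.
Proof.
move=> T_gt0 e_ge0 heavy missed patB.
pose S := {ffun 'I_N -> T}.
have /choice[g gP] : forall s : S, exists g, G g /\ forall j, g (s j) = false.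
  by move=> s; have [g Gg gs] := missed s; exists g.
pose ghost (s s' : S) : R := \prod_j (1 + (g s (s' j))%:R).
pose mix (sg : {ffun 'I_N -> bool}) (p : S * S) b : S :=
  [ffun j => if b (+) sg j then p.2 j else p.1 j].
pose t : R := #|T|%:R.
have t_gt0 : 0 < t by rewrite ltr0n.
have lower sg : t ^+ N * ((1 + e) * t) ^+ N <=
    \sum_p ghost (mix sg p false) (mix sg p true).
  pose swap p := (mix sg p false, mix sg p true).
  have swapK : involutive swap.
    case=> s s'; congr pair; apply/ffunP => j; rewrite !ffunE;
    by case: (sg j).
  rewrite -(reindex_inj (inv_inj swapK) (P := predT) (F := fun p => ghost p.1 p.2)) /=.
  rewrite -(pair_big predT predT ghost) /=.
  have -> : t ^+ N = \sum_(s : S) 1.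
    by rewrite sumr_const card_ffun card_ord natrX.
  rewrite mulr_suml; apply: ler_sum => s _; rewrite mul1r.
  rewrite /ghost -(bigA_distr_bigA (fun _ x => 1 + (g s x)%:R : R)) /=.
  rewrite prodr_const card_ord lerXn2r ?nnegrE ?mulr_ge0 ?addr_ge0 ?ler01 ?(ltW t_gt0) //.
    by apply: sumr_ge0 => x _; rewrite addr_ge0.
  rewrite big_split /= sumr_const mulrDl mul1r lerD2l.
  by apply: heavy; have [] := gP s.
have upper p : \sum_sg ghost (mix sg p false) (mix sg p true) <= 2 ^+ N * B.
  (* Bound the single pattern that occurs for [sg] by the sum over all patterns,
     in order to exchange the sums over swaps and patterns. *)
  pose q (jb : 'I_N * bool) := if jb.2 then p.2 jb.1 else p.1 jb.1.
  pose pat (sg : {ffun 'I_N -> bool}) := [ffun jb => g (mix sg p false) (q jb)].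
  pose F := [set P : {ffun 'I_N * bool -> bool} |
               `[< exists2 g, G g & P =1 g \o q >]]%SET.
  pose w (P : {ffun 'I_N * bool -> bool}) j b : R :=
    (~~ P (j, b))%:R * (1 + (P (j, ~~ b))%:R).
  have w_ge0 P j b : 0 <= w P j b by rewrite mulr_ge0 // addr_ge0.
  have ghostE sg : ghost (mix sg p false) (mix sg p true) = \prod_j w (pat sg) j (sg j).
    apply: eq_bigr => j _; rewrite /w !ffunE /q /=.
    have [_ /(_ j)] := gP (mix sg p false).
    by rewrite !ffunE /=; case: (sg j) => /= ->; rewrite mul1r.
  apply: (@le_trans _ _ (\sum_(sg : {ffun _ -> bool}) \sum_(P in F) \prod_j w P j (sg j))).
    apply: ler_sum => sg _; rewrite ghostE (bigD1 (pat sg)) /=; last first.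
      rewrite inE; apply/asboolP; exists (g (mix sg p false)).
        by have [] := gP (mix sg p false).
      by move=> jb; rewrite ffunE.
    by rewrite lerDl sumr_ge0 // => P _; apply: prodr_ge0.
  rewrite exchange_big /=; apply: (@le_trans _ _ (\sum_(P in F) 2 ^+ N)).
    apply: ler_sum => P _; rewrite -(bigA_distr_bigA (w P)) /=.
    have -> : 2 ^+ N = \prod_(j < N) 2 :> R by rewrite prodr_const card_ord.
    apply: ler_prod => j _; rewrite sumr_ge0 //= big_bool /w /=.
    by case: (P (j, true)); case: (P (j, false)) => /=; lra.
  by rewrite sumr_const -[leLHS]mulr_natr ler_pM2l ?exprn_gt0 //; apply: patB.
have : \sum_(sg : {ffun 'I_N -> bool}) t ^+ N * ((1 + e) * t) ^+ N <=
       \sum_(p : S * S) 2 ^+ N * B.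
  apply: (@le_trans _ _ (\sum_sg \sum_p ghost (mix sg p false) (mix sg p true))).
    exact: ler_sum.
  by rewrite exchange_big; apply: ler_sum.
rewrite !sumr_const card_prod !card_ffun card_bool card_ord.
rewrite -[leLHS]mulr_natl -[leRHS]mulr_natl natrM !natrX -/t.
have -> : 2 ^+ N * (t ^+ N * ((1 + e) * t) ^+ N) =
          2 ^+ N * (t ^+ N * t ^+ N) * (1 + e) ^+ N.
  by rewrite exprMn; ring.
have -> : t ^+ N * t ^+ N * (2 ^+ N * B) = 2 ^+ N * (t ^+ N * t ^+ N) * B by ring.
by rewrite ler_pM2l // !mulr_gt0 ?exprn_gt0.
Qed.

(** * Learning from few points with error below one half *)

(** Here 12 and 24 are the sizes per unit of VC dimension of the sample and of
    the double sample, and 3/7 is the error that is to be beaten; the value 20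
    nearly minimizes the Sauer-Shelah bound K * (1 + 1/K) ^ 24, which is about
    64.5, whereas (10/7) ^ 12 is about 72.3. *)
Lemma pattern_growth_lt (R : realFieldType) (d : nat) : (0 < d)%N ->
  20 ^+ d * (1 + 20^-1) ^+ (24 * d) < (1 + 3 / 7) ^+ (12 * d) :> R.
Proof.
move=> d_gt0; rewrite !exprM -exprMn ltrXn2r ?gtn_eqF //.
lra.
Qed.

(** Otherwise the sets of errors h + f modulo 2, for h in H, would all have density at
    least 3/7 on the given points, although any 12 * d points are missed by one
    of them; this contradicts [double_sampling], because adding f to all the
    members of H does not change its VC dimension. *)
Lemma weak_learner (X : Type) (H : hclass X) (f : X -> bool) (d m : nat)
    (p : 'I_m -> X) :
  (0 < d)%N -> (0 < m)%N ->
  (forall x : 'I_d.+1 -> X, injective x ->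
     ~ forall y : 'I_d.+1 -> bool, exists2 h, H h & forall i, h (x i) = y i) ->
  agrees_on (12 * d) H f ->
  exists2 h, H h & (7 * \sum_i (h (p i) != f (p i)) < 3 * m)%N.
Proof.
move=> d_gt0 m_gt0 vcH agr; apply/not_exists2P => far.
pose G : hclass 'I_m := [set g | exists2 h, H h & g = fun i => h (p i) != f (p i)].
have large (R : realFieldType) :
    (1 + 3 / 7 : R) ^+ (12 * d) <= 20 ^+ d * (1 + 20^-1) ^+ (24 * d).
  apply: (@double_sampling _ 'I_m G); first by rewrite card_ord.
  - by rewrite divr_ge0.
  - move=> g [h Hh ->]; have [//|] := far h.
    rewrite ltnNge => /negP/negPn; rewrite -(ler_nat R) !natrM natr_sum card_ord; lra.
  - move=> q; have [h Hh hq] := agr (p \o q).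
    exists (fun i => h (p i) != f (p i)); first by exists h.
    by move=> j; have /= -> := hq j; rewrite eqxx.
  move=> q; pose A : hclass ('I_(12 * d) * bool) :=
    [set P : 'I_(12 * d) * bool -> bool | exists2 g, G g & P =1 g \o q].
  apply: (@le_trans _ _ #|patterns A (enum {: 'I_(12 * d) * bool})|%:R).
    by rewrite ler_nat; apply: (card_ffun_patterns A).
  have -> : (24 * d = size (enum {: 'I_(12 * d) * bool}))%N.
    by rewrite -cardE card_prod card_ord card_bool; lia.
  apply: card_patterns => [|u _ ud shat]; first by rewrite (ler_nat R 1).
  case: u ud shat => [//|u0 u'] ; set u := u0 :: u' => ud shat.
  have real_u (y : 'I_d.+1 -> bool) : exists2 h, H h &
      forall i : 'I_d.+1, (h (p (q (nth u0 u i))) != f (p (q (nth u0 u i)))) = y i.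
    have [|h [g [h' Hh' ->] hE] hu] := shat [seq y i | i <- enum 'I_d.+1].
      by rewrite size_map size_enum_ord.
    exists h' => // i; have /= <- := hE (nth u0 u i).
    rewrite -(nth_map _ false) ?ud ?ltn_ord // hu (nth_map i) ?size_enum_ord //.
    by rewrite nth_ord_enum.
  apply: (vcH (fun i : 'I_d.+1 => p (q (nth u0 u i)))).
    move=> i j /= eq_ij; have [h _ hy] := real_u (pred1 i).
    by have := hy j; rewrite -eq_ij hy /= eqxx => /esym/eqP.
  move=> y; have [h Hh hy] := real_u (fun i : 'I_d.+1 => y i (+) f (p (q (nth u0 u i)))).
  by exists h => // i; move: (hy i); case: (h _) (f _) (y i) => [] [] [].
by have := lt_le_trans (pattern_growth_lt rat d_gt0) (large rat); rewrite ltxx.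
Qed.

(** * Counting nearly realized branches of a tree *)

Definition restrict (X : Type) (H : hclass X) (x : X) (b : bool) : hclass X :=
  [set h : X -> bool | H h /\ h x = b].

Definition no_shattered_tree (X : Type) (H : hclass X) (n : nat) :=
  forall t, full n t -> ~ tree_shattered H n t.

Lemma no_shattered_tree0 (X : Type) (H : hclass X) :
  no_shattered_tree H 0 -> forall h, ~ H h.
Proof.
by move=> nH h Hh; apply: (nH Leaf) => // y; exists h.
Qed.

Lemma no_shattered_treeW (X : Type) (H H' : hclass X) (n : nat) :
  H' `<=` H -> no_shattered_tree H n -> no_shattered_tree H' n.
Proof.
move=> sH nH t ft shat; apply: (nH t ft) => y.
by have [h /sH Hh hy] := shat y; exists h.
Qed.

(** If both restrictions at [x] shatter a tree of height n, then joining the two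
    trees at a root labelled [x] gives a shattered tree of height n + 1. *)
Lemma no_shattered_treeS (X : Type) (H : hclass X) (n : nat) (x : X) :
  no_shattered_tree H n.+1 -> exists b, no_shattered_tree (restrict H x b) n.
Proof.
move=> nH; apply/not_existsP => shat.
have tree b : exists t, full n t /\ tree_shattered (restrict H x b) n t.
  have /existsNP[t /not_implyP[ft /contrapT st]] := shat b.
  by exists t.
have [l [fl sl]] := tree false; have [r [fr sr]] := tree true.
apply: (nH (Node x l r)) => /=; first by rewrite fl fr.
case/tupleP => -[] y /=.
  by have [h [Hh hx] hy] := sr y; exists h => //=; rewrite hx eqxx.
by have [h [Hh hx] hy] := sl y; exists h => //=; rewrite hx eqxx.
Qed.

Definition mistakes (X : Type) (h : X -> bool) (s : seq (X * bool)) : nat :=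
  count (fun p => h p.1 != p.2) s.

(** The sum of beta ^ k over the ways to err k times along [s] while staying
    realized by [H].  It dominates beta to the least number of errors that a
    member of [H] makes on [s], and its sum over the branches of a tree obeys a
    simple recursion. *)
Fixpoint weight (R : realFieldType) (X : Type) (beta : R) (H : hclass X)
    (s : seq (X * bool)) : R :=
  if s is (x, b) :: s' then
    weight beta (restrict H x b) s' + beta * weight beta (restrict H x (~~ b)) s'
  else `[< H !=set0 >]%:R.

Lemma weight_ge0 (R : realFieldType) (X : Type) (beta : R) (H : hclass X) s :
  0 <= beta -> 0 <= weight beta H s.
Proof.
move=> beta0; elim: s H => [|[x b] s IHs] H //=.
by rewrite addr_ge0 // mulr_ge0.
Qed.

Lemma weight_empty (R : realFieldType) (X : Type) (beta : R) (H : hclass X) s :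
  (forall h, ~ H h) -> weight beta H s = 0.
Proof.
elim: s H => [|[x b] s IHs] H H0 /=.
  by rewrite (_ : `[< _ >] = false) //; apply/asboolP => -[h /H0].
by rewrite !IHs ?mulr0 ?addr0 // => h [/H0].
Qed.

Lemma weight_mistakes (R : realFieldType) (X : Type) (beta : R) (H : hclass X) h s :
  0 <= beta -> H h -> beta ^+ mistakes h s <= weight beta H s.
Proof.
move=> beta0; elim: s H => [|[x b] s IHs] H Hh /=.
  by rewrite (_ : `[< _ >] = true) //; apply/asboolP; exists h.
rewrite /mistakes /= -/(mistakes h s).
case: eqVneq => hx; rewrite ?add0n ?add1n.
  by rewrite (le_trans (IHs (restrict H x b) _)) // lerDl mulr_ge0 ?weight_ge0.
rewrite exprS -[leLHS]add0r lerD ?weight_ge0 // ler_wpM2l // IHs //; split=> //.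
by move: hx; case: (h x) b => [] [].
Qed.

(** At the root, both answers are possible, with or without an error, so the sum
    S satisfies S(H) = (1 + beta) * (S(H0) + S(H1)) for the two restrictions of
    [H], up to the choice of the subtrees; one of the restrictions shatters only
    smaller trees than [H].  This is Pascal's recursion with a factor 1 + beta,
    and K plays the same part as in [card_patterns]. *)
Lemma weight_tree (R : realFieldType) (X : Type) (beta K : R) (H : hclass X)
    (m n : nat) (t : btree X) :
  0 <= beta -> 1 <= K -> full m t -> no_shattered_tree H n ->
  \sum_(y : m.-tuple bool) weight beta H (branch t y) <=
    K ^+ n * ((1 + beta) * (1 + K^-1)) ^+ m.
Proof.
move=> beta0 K1; have K0 : 0 < K by apply: lt_le_trans K1.
have rho0 : 0 <= (1 + beta) * (1 + K^-1).
  by rewrite mulr_ge0 ?addr_ge0 ?invr_ge0 ?(ltW K0).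
elim: m t H n => [|m IHm] [|x l r] H n // ft nH.
  rewrite expr0 mulr1; apply: (@le_trans _ _ 1); last exact: exprn_ege1.
  rewrite /= sumr_const card_tuple expn0 mulr1n.
  by case: (`[< _ >]).
case: n nH => [/no_shattered_tree0 H0|n nH].
  by rewrite big1 ?mulr_ge0 ?exprn_ge0 ?(ltW K0) // => y _; exact: weight_empty.
have /andP[fl fr] := ft.
rewrite big_tuple_cons /= !big_split /= -!mulr_sumr.
set rho := _ * (1 + _) in rho0 IHm *.
(* Which of the two restrictions has the smaller dimension is immaterial. *)
have total k0 k1 : no_shattered_tree (restrict H x false) k0 ->
    no_shattered_tree (restrict H x true) k1 ->
    K ^+ k0 + K ^+ k1 = K ^+ n + K ^+ n.+1 ->
  \sum_(y : m.-tuple bool) weight beta (restrict H x false) (branch l y) +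
  beta * \sum_(y : m.-tuple bool) weight beta (restrict H x true) (branch l y) +
  (\sum_(y : m.-tuple bool) weight beta (restrict H x true) (branch r y) +
  beta * \sum_(y : m.-tuple bool) weight beta (restrict H x false) (branch r y)) <=
  K ^+ n.+1 * rho ^+ m.+1.
  move=> n0 n1 Kk.
  have l0 := IHm _ _ _ fl n0; have l1 := IHm _ _ _ fl n1.
  have r0 := IHm _ _ _ fr n0; have r1 := IHm _ _ _ fr n1.
  apply: le_trans (lerD (lerD l0 (ler_wpM2l beta0 l1)) (lerD r1 (ler_wpM2l beta0 r0))) _.
  have -> : K ^+ n.+1 * rho ^+ m.+1 = (1 + beta) * (K ^+ k0 + K ^+ k1) * rho ^+ m.
    rewrite Kk !exprS /rho; set a := _ ^+ m; field; exact: lt0r_neq0.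
  by rewrite le_eqVlt; apply/orP; left; apply/eqP; ring.
have nHr b : no_shattered_tree (restrict H x b) n.+1.
  by apply: no_shattered_treeW nH => h [].
have [[] nb] := no_shattered_treeS x nH; first by apply: (total n.+1 n); rewrite // addrC.
exact: (total n n.+1).
Qed.

Lemma bernoulli_le (R : realFieldType) (x : R) (n : nat) :
  0 <= x -> 1 + n%:R * x <= (1 + x) ^+ n.
Proof.
move=> x0; elim: n => [|n IHn]; first by rewrite mul0r addr0.
have n0 : 0 <= n%:R * x * x by rewrite !mulr_ge0.
by rewrite exprS -natr1; apply: le_trans (ler_wpM2l _ IHn); [lra|rewrite addr_ge0].
Qed.

(** For errors of proportion 3/7, the Chernoff exponent is optimal at
    beta = (3/7) / (4/7).  The value 150 of K is large enough for the factor
    1 + 1/K not to absorb the gain.  The seventh power avoids rational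
    exponents. *)
Lemma height_exp_le (R : realFieldType) (X : Type) (H : hclass X) (m n : nat)
    (t : btree X) :
  full m t -> no_shattered_tree H n ->
  (forall y : m.-tuple bool,
     exists2 h, H h & (7 * mistakes h (branch t y) <= 3 * m)%N) ->
  (1 + 50^-1) ^+ m <= 150 ^+ (7 * n) :> R.
Proof.
move=> ft nH near; pose beta : R := 3 / 4; pose rho : R := (1 + beta) * (1 + 150^-1).
have beta_gt0 : 0 < beta by rewrite /beta; lra.
have beta_ge0 := ltW beta_gt0.
have beta_le1 : beta <= 1 by rewrite /beta; lra.
have rho_gt0 : 0 < rho by rewrite /rho /beta; lra.
have gap : rho ^+ 7 * (1 + 50^-1) <= 2 ^+ 7 * beta ^+ 3 by rewrite /rho /beta; lra.
have K1 : 1 <= 150 :> R by rewrite (ler_nat R 1).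
pose a := (3 * m %/ 7)%N.
have lower : 2 ^+ m * beta ^+ a <= \sum_(y : m.-tuple bool) weight beta H (branch t y).
  have -> : 2 ^+ m * beta ^+ a = \sum_(y : m.-tuple bool) beta ^+ a.
    by rewrite sumr_const card_tuple card_bool -[RHS]mulr_natl natrX.
  apply: ler_sum => y _; have [h Hh hy] := near y.
  apply: le_trans (weight_mistakes (branch t y) beta_ge0 Hh).
  by rewrite ler_wiXn2l // leq_divRL // mulnC.
have {lower} := le_trans lower (weight_tree beta_ge0 K1 ft nH).
rewrite -/rho => le7; clearbody rho; clearbody beta.
have {le7} : (2 ^+ m * beta ^+ a) ^+ 7 <= (150 ^+ n * rho ^+ m) ^+ 7.
  by rewrite lerXn2r ?nnegrE ?mulr_ge0 ?exprn_ge0 ?ler0n ?(ltW rho_gt0).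
rewrite !exprMn -!exprM => le7.
have beta7 : beta ^+ (3 * m) <= beta ^+ (a * 7) by rewrite ler_wiXn2l // leq_divM.
rewrite -(@ler_pM2l _ (rho ^+ (m * 7))) ?exprn_gt0 // mulrC [leRHS]mulrC [in leRHS]mulnC.
apply: le_trans le7.
apply: (@le_trans _ _ (2 ^+ (m * 7) * beta ^+ (3 * m))); last by rewrite ler_wpM2l ?exprn_ge0.
rewrite mulrC [(m * 7)%N]mulnC !exprM -!exprMn lerXn2r ?nnegrE ?mulr_ge0 ?exprn_ge0
  ?(ltW rho_gt0) ?addr_ge0 //.
Qed.

Lemma height_le (X : Type) (H : hclass X) (m n : nat) (t : btree X) :
  full m t -> no_shattered_tree H n ->
  (forall y : m.-tuple bool,
     exists2 h, H h & (7 * mistakes h (branch t y) <= 3 * m)%N) ->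
  (m <= 50 * 149 * (7 * n))%N.
Proof.
move=> ft nH near; rewrite leqNgt; apply/negP => lt_m.
have up (R : realFieldType) := @height_exp_le R X H m n t ft nH near.
have low (R : realFieldType) : 150 ^+ (7 * n) < (1 + 50^-1) ^+ m :> R.
  have x0 : 0 <= 50^-1 :> R by rewrite invr_ge0.
  (* By Bernoulli's inequality, (1 + 1/50) ^ (50 * 149) >= 1 + 149. *)
  apply: (@le_lt_trans _ _ ((1 + 50^-1) ^+ (50 * 149 * (7 * n)))).
    rewrite [leRHS]exprM lerXn2r ?nnegrE ?exprn_ge0 ?addr_ge0 //.
    by apply: le_trans (bernoulli_le _ x0); rewrite natrM; lra.
  by rewrite ltr_eXn2l // ltrDl invr_gt0.
by have := lt_le_trans (low rat) (up rat); rewrite ltxx.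
Qed.

(** * Littlestone dimension of the saturation *)

Lemma size_branch (X : Type) (m : nat) (t : btree X) (y : m.-tuple bool) :
  full m t -> size (branch t y) = m.
Proof.
elim: m t y => [|m IHm] [|x l r] y //=; case/tupleP: y => b y /= /andP[fl fr].
by case: b; rewrite IHm.
Qed.

Lemma Ldim_locally_agreeing (R : realType) (X : Type) (H G : hclass X) (ell d : nat) :
  Ldim R H = (ell%:R)%:E -> VCdim R H = (d%:R)%:E -> (0 < d)%N ->
  (forall f, G f -> agrees_on (12 * d) H f) ->
  (Ldim R G <= (50 * 149 * (7 * (ell%:R + 1)))%:E)%E.
Proof.
move=> /sup_natP[_ ldimH] /sup_natP[_ vcH] d_gt0 agr.
apply: ge_ereal_sup => _ [m [t ft shat] <-]; rewrite lee_fin.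
rewrite natr1 -!natrM ler_nat; have [->|m_gt0] := posnP m; first exact: leq0n.
apply: (@height_le X H m ell.+1 t ft).
  by move=> t' ft' st'; have := ldimH ell.+1; rewrite ltnn => /(_ _)/notF;
    apply; exists t'.
move=> y; have [f Gf fy] := shat y; set s := branch t y in fy *.
have sm : size s = m by exact: size_branch.
pose p (i : 'I_(size s)) := (tnth (in_tuple s) i).1.
have [|||h Hh hp] := @weak_learner X H f d (size s) p d_gt0; last 1 first.
- exists h => //; rewrite -sm ltnW //; congr (7 * _ < _)%N: hp.
  rewrite /mistakes -sum1_count [RHS]big_mkcond [RHS]big_tnth; apply: eq_bigr => i _.
  have /all_tnthP/(_ i)/eqP <- : all (fun p => f p.1 == p.2) (in_tuple s) by [].
  by rewrite /p; case: eqP.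
- by rewrite sm.
- move=> x x_inj xH; have := vcH d.+1; rewrite ltnn => /(_ _)/notF.
  by apply; exists x.
- exact: agr.
Qed.

Theorem theorem7p1 (R : realType) :
  exists C : R,
    `|C - (12 + 412 / 10 ^+ 4)| <= 5 / 10 ^+ 5 /\
    (forall (X : Type) (H : hclass X) (ell d : nat),
       Ldim R H = (ell%:R)%:E -> VCdim R H = (d%:R)%:E -> (1 <= d)%N ->
       forall eps : R, 0 < eps -> eps < 1 / (C * d%:R) ->
       littlestone R (saturation H eps)) /\
    exists B : R -> R -> R,
      forall d : nat, (1 <= d)%N ->
      forall C' : R, C <= C' ->
      forall eps1 : R, 0 < eps1 -> eps1 < 1 / 2 ->
        20 * (d%:R / eps1) * log10 (1 / eps1) < C' * d%:R ->
      forall eps2 : R, 0 < eps2 -> eps2 < 1 / 2 -> eps1 < eps2 ->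
      forall eps3 : R, 0 < eps3 -> eps3 < 1 / 2 - eps2 ->
      forall (X : Type) (H : hclass X) (ell : nat),
        Ldim R H = (ell%:R)%:E -> VCdim R H = (d%:R)%:E ->
      forall eps : R, 0 < eps -> eps < 1 / (C' * d%:R) ->
        (Ldim R (saturation H eps) <= (B (d%:R / eps3 ^+ 2) ell%:R)%:E)%E.
Proof.
pose C : R := 12 + 412 / 10 ^+ 4.
have C_ge12 : 12 <= C by rewrite /C; lra.
have bound C' (X : Type) (H : hclass X) (ell d : nat) (eps : R) :
    C <= C' -> Ldim R H = (ell%:R)%:E -> VCdim R H = (d%:R)%:E -> (1 <= d)%N ->
    0 < eps -> eps < 1 / (C' * d%:R) ->
    (Ldim R (saturation H eps) <= (50 * 149 * (7 * (ell%:R + 1)))%:E)%E.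
  move=> CC' ldimH vcH d_gt0 eps_gt0.
  have d0 : 0 < d%:R :> R by rewrite ltr0n.
  have C'12 := le_trans C_ge12 CC'.
  have C'd_gt0 : 0 < C' * d%:R by rewrite mulr_gt0 //; apply: lt_le_trans C'12.
  rewrite ltr_pdivlMr // => small.
  apply: Ldim_locally_agreeing ldimH vcH d_gt0 _ => f; apply: saturation_agrees.
  apply: le_lt_trans small; rewrite mulrC ler_pM2l // natrM.
  by rewrite ler_wpM2r // ltW.
exists C; split; first by rewrite subrr normr0 divr_ge0 // exprn_ge0.
split=> [X H ell d ldimH vcH d_gt0 eps eps_gt0 eps_lt|].
  exact: le_lt_trans (bound C X H ell d eps _ ldimH vcH _ _ _) (ltry _).
exists (fun _ ell => 50 * 149 * (7 * (ell + 1))).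
move=> d d_gt0 C' CC' _ _ _ _ _ _ _ _ _ _ _ X H ell ldimH vcH eps eps_gt0 eps_lt.
exact: (bound C' X H ell d eps).
Qed.
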